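(* Let $G_1$ and $G_2$ be finite simple graphs, each with at least two vertices, and let $\epsilon$ be a real number. If $C(G_1) \le \epsilon$ and $C(G_2) \le \epsilon$, then $$C(G_1 + G_2) \leq \frac{1 + \epsilon}{2} + \frac{1-\epsilon}{2\log_2 (|V(G_1)| + |V(G_2)|)},$$ where $G_1 + G_2$ denotes the disjoint union of $G_1$ and $G_2$ and $C(\cdot)$ denotes the normalized Shannon capacity.
   Context: All graphs are finite, simple and undirected. The strong product $G_1 \times G_2$ of graphs $G_1$ and $G_2$ is the graph on $V(G_1) \times V(G_2)$ in which two distinct vertices $(u_1,u_2)$ and $(v_1,v_2)$ are adjacent if and only if for each $i=1,2$ we have $u_i = v_i$ or $u_i v_i \in E(G_i)$. For $n \ge 1$, $G^n$ denotes the $n$-fold strong power of $G$, i.e. the strong product of $n$ copies of $G$. For a graph $H$, $\alpha(H)$ denotes its independence number, the maximum size of an independent set of vertices of $H$. The Shannon capacity of $G$ is $c(G) = \lim_{n\to\infty} \alpha(G^n)^{1/n}$ (the limit exists and equals $\sup_{n \ge 1} \alpha(G^n)^{1/n}$). The normalized Shannon capacity of a graph $G$ with $|V(G)| \ge 2$ is $C(G) = \frac{\log c(G)}{\log |V(G)|}$. The disjoint union $G_1 + G_2$ is the graph whose vertex set is the disjoint union of $V(G_1)$ and $V(G_2)$ and whose edges are exactly those of $G_1$ together with those of $G_2$ (no edges between the two parts). *)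

(* Defs.v *)
From HB Require Import structures.
From mathcomp Require Import all_boot all_order all_algebra.
From mathcomp Require Import all_classical all_reals all_analysis.

Set Implicit Arguments.
Unset Strict Implicit.
Unset Printing Implicit Defensive.

Import Order.TTheory GRing.Theory Num.Theory.
Import numFieldNormedType.Exports.

Record sgraph := SGraph {
  svertex :> finType;
  sedge : rel svertex;
  sedge_sym : symmetric sedge;
  sedge_irrefl : irreflexive sedge
}.

Section StrongProduct.
Variables G1 G2 : sgraph.

Definition strong_rel : rel (svertex G1 * svertex G2)%type := fun u v =>
  [&& u != v,
      (u.1 == v.1) || sedge u.1 v.1
    & (u.2 == v.2) || sedge u.2 v.2].

Lemma strong_rel_sym : symmetric strong_rel.
Proof.
move=> u v; rewrite /strong_rel (eq_sym u) (eq_sym u.1) (eq_sym u.2).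
by rewrite (sedge_sym u.1) (sedge_sym u.2).
Qed.

Lemma strong_rel_irrefl : irreflexive strong_rel.
Proof. by move=> u; rewrite /strong_rel eqxx. Qed.

Definition strong_prod : sgraph := SGraph strong_rel_sym strong_rel_irrefl.

End StrongProduct.

Section DisjointUnion.
Variables G1 G2 : sgraph.

Definition union_rel : rel (svertex G1 + svertex G2)%type := fun u v =>
  match u, v with
  | inl x, inl y => sedge x y
  | inr x, inr y => sedge x y
  | _, _ => false
  end.

Lemma union_rel_sym : symmetric union_rel.
Proof. by move=> [x|x] [y|y] //=; rewrite sedge_sym. Qed.

Lemma union_rel_irrefl : irreflexive union_rel.
Proof. by move=> [x|x] /=; rewrite sedge_irrefl. Qed.

Definition disjoint_union : sgraph := SGraph union_rel_sym union_rel_irrefl.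

End DisjointUnion.

Lemma empty_rel_sym (T : finType) : symmetric (fun _ _ : T => false).
Proof. by []. Qed.

Lemma empty_rel_irrefl (T : finType) : irreflexive (fun _ _ : T => false).
Proof. by []. Qed.

Definition one_vertex_graph : sgraph :=
  SGraph (@empty_rel_sym unit) (@empty_rel_irrefl unit).

(* [iterop] gives G^1 = G and G^(n+2) = G x G^(n+1); the value at n = 0, the
   one-vertex graph, is only a convention. *)
Definition strong_pow (G : sgraph) (n : nat) : sgraph :=
  iterop n strong_prod G one_vertex_graph.

Definition independent (G : sgraph) (S : {set G}) : bool :=
  [forall x in S, forall y in S, ~~ sedge x y].

Definition alpha (G : sgraph) : nat := \max_(S : {set G} | independent S) #|S|.

Local Open Scope ring_scope.
Local Open Scope classical_set_scope.

(* The term at n = 0 has exponent 0^-1 = 0; it does not affect the limit. *)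
Definition shannon_capacity (R : realType) (G : sgraph) : R :=
  lim (((alpha (strong_pow G n))%:R : R) `^ (n%:R)^-1 @[n --> \oo]).

Definition normalized_capacity (R : realType) (G : sgraph) : R :=
  ln (shannon_capacity R G) / ln (#|G|%:R).

Definition log2 (R : realType) (x : R) : R := ln x / ln 2.

(* Main.v *)
(* Expanding (G1 + G2)^n over the 2^n choices of a summand in each coordinate
   bounds alpha((G1 + G2)^n) by a sum of terms alpha(G1^a x G2^b), a + b = n.
   Such a term is at most alpha(G1^a) |G2|^b and at most |G1|^a alpha(G2^b),
   hence at most their geometric mean, which is at most x^a y^b with
   x = sqrt(c(G1) |G1|) and y = sqrt(c(G2) |G2|). Therefore
   c(G1 + G2) <= x + y <= |G1|^s + |G2|^s with s = (1 + epsilon) / 2, and the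
   concavity of t |-> t^s bounds this by 2^(1 - s) (|G1| + |G2|)^s. Concavity
   needs s <= 1; for epsilon > 1 the bound is implied by
   c(G1 + G2) <= |G1| + |G2|. *)
Require Import Defs.
From HB Require Import structures.
From mathcomp Require Import all_boot all_order all_algebra.
From mathcomp Require Import all_classical all_reals all_analysis.
From mathcomp Require Import ring lra.

Set Implicit Arguments.
Unset Strict Implicit.
Unset Printing Implicit Defensive.

Import Order.TTheory GRing.Theory Num.Theory.
Import numFieldNormedType.Exports.

(** * Independence numbers of strong products, disjoint unions and powers *)

(** With equality allowed, adjacency in a strong product becomes a plain coordinatewise conjunction,
    as [close_prod] shows. *)
Definition close (G : sgraph) : rel G := fun x y => (x == y) || sedge x y.

Lemma close_refl (G : sgraph) (x : G) : close x x.
Proof. by rewrite /close eqxx. Qed.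

Lemma close_prod (G H : sgraph) (u v : strong_prod G H) :
  close u v = close u.1 v.1 && close u.2 v.2.
Proof.
rewrite /close /= /strong_rel; case: (eqVneq u v) => [->|_] //=.
by rewrite !eqxx.
Qed.

Lemma independentP (G : sgraph) (S : {set G}) :
  reflect {in S &, forall x y, close x y -> x = y} (independent S).
Proof.
apply: (iffP forall_inP) => [indS x y xS yS | clS x xS].
  case/orP=> [/eqP //|]; by rewrite (negPf (forall_inP (indS x xS) y yS)).
apply/forall_inP => y yS; apply/negP => xy.
by move: (xy); rewrite (clS x y) ?sedge_irrefl // /close xy orbT.
Qed.

Lemma alpha_max (G : sgraph) (S : {set G}) : independent S -> #|S| <= alpha G.
Proof. exact: leq_bigmax_cond. Qed.

Lemma alpha_witness (G : sgraph) :
  exists2 S : {set G}, independent S & #|S| = alpha G.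
Proof.
have ind0 : 0 < #|[pred S : {set G} | independent S]|.
  by apply/card_gt0P; exists finset.set0; apply/independentP => x y; rewrite inE.
have [S indS SE] := eq_bigmax_cond (fun S : {set G} => #|S|) ind0.
by exists S.
Qed.

Lemma alpha_le_card (G : sgraph) : alpha G <= #|G|.
Proof. by apply/bigmax_leqP => S _; exact: max_card. Qed.

Lemma alpha_gt0 (G : sgraph) : 0 < #|G| -> 0 < alpha G.
Proof.
case/card_gt0P => x _; rewrite -(cards1 x); apply: alpha_max.
by apply/independentP => y z /set1P-> /set1P->.
Qed.

(* Such a map sends independent sets injectively to independent sets, because
   [close] is reflexive. *)
Definition cohom (G H : sgraph) :=
  exists f : G -> H, forall x y, close (f x) (f y) -> close x y.

Lemma cohom_refl (G : sgraph) : cohom G G. Proof. by exists id. Qed.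

Lemma cohom_trans (G H K : sgraph) : cohom G H -> cohom H K -> cohom G K.
Proof. by move=> [f fP] [g gP]; exists (g \o f) => x y /gP/fP. Qed.

Lemma cohom_prod (G G' H H' : sgraph) :
  cohom G G' -> cohom H H' -> cohom (strong_prod G H) (strong_prod G' H').
Proof.
move=> [f fP] [g gP].
exists (fun u : strong_prod G H => (f u.1, g u.2)) => u v.
by rewrite !close_prod /= => /andP[/fP-> /gP->].
Qed.

Lemma cohom_prodA (G H K : sgraph) :
  cohom (strong_prod G (strong_prod H K)) (strong_prod (strong_prod G H) K).
Proof.
exists (fun u : strong_prod G (strong_prod H K) => ((u.1, u.2.1), u.2.2)).
by move=> u v; rewrite !close_prod /= andbA.
Qed.

Lemma cohom_prodCA (G H K : sgraph) :
  cohom (strong_prod G (strong_prod H K)) (strong_prod H (strong_prod G K)).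
Proof.
exists (fun u : strong_prod G (strong_prod H K) => (u.2.1, (u.1, u.2.2))).
by move=> u v; rewrite !close_prod /= andbCA.
Qed.

Lemma alpha_cohom (G H : sgraph) : cohom G H -> alpha G <= alpha H.
Proof.
move=> [f fP]; have [S /independentP indS <-] := alpha_witness G.
have finj : {in S &, injective f}.
  by move=> x y xS yS fxy; apply: indS => //; apply: fP; rewrite fxy close_refl.
rewrite -(card_in_imset finj); apply: alpha_max; apply/independentP.
by move=> _ _ /imsetP[x xS ->] /imsetP[y yS ->] /fP/indS ->.
Qed.

Lemma alpha_prod_ge (G H : sgraph) :
  alpha G * alpha H <= alpha (strong_prod G H).
Proof.
have [S /independentP indS <-] := alpha_witness G.
have [T /independentP indT <-] := alpha_witness H.
rewrite -cardsX; apply: (@alpha_max (strong_prod G H)); apply/independentP.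
move=> [x y] [x' y'] /setXP[xS yT] /setXP[x'S y'T].
by rewrite close_prod /= => /andP[/indS-> // /indT->].
Qed.

(** Slice an independent set by its second coordinate. Two points over the same [h] are close as
    soon as their first coordinates are, so each of the [#|H|] slices projects injectively onto an
    independent set of [G]. *)
Lemma alpha_prod_le_card (G H : sgraph) :
  alpha (strong_prod G H) <= alpha G * #|H|.
Proof.
have [S /independentP indS <-] := alpha_witness (strong_prod G H).
rewrite -sum1_card (partition_big (fun u : strong_prod G H => u.2) predT) //=.
rewrite mulnC -sum_nat_const; apply: leq_sum => h _.
rewrite sum1dep_card -(@card_in_imset _ _ fst).
  apply: alpha_max; apply/independentP.
  move=> _ _ /imsetP[[x h1] + ->] /imsetP[[y h2] + ->] /=.
  rewrite !inE /= => /andP[xS /eqP h1E] /andP[yS /eqP h2E] xy.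
  move: xS yS; rewrite h1E h2E => xS yS.
  have /(congr1 fst) //: (x, h) = (y, h).
  by apply: indS => //; rewrite close_prod /= xy close_refl.
move=> [x h1] [y h2]; rewrite !inE /=.
by move=> /andP[_ /eqP->] /andP[_ /eqP->] ->.
Qed.

(** An independent set splits according to the summand of its first coordinate, and each half pulls
    back along [inl] or [inr] to an independent set. *)
Lemma alpha_union_prod (G1 G2 H : sgraph) :
  alpha (strong_prod (disjoint_union G1 G2) H) <=
  alpha (strong_prod G1 H) + alpha (strong_prod G2 H).
Proof.
have [S /independentP indS <-] :=
  alpha_witness (strong_prod (disjoint_union G1 G2) H).
pose f1 (u : strong_prod G1 H) : strong_prod (disjoint_union G1 G2) H :=
  (inl u.1, u.2).
pose f2 (u : strong_prod G2 H) : strong_prod (disjoint_union G1 G2) H :=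
  (inr u.1, u.2).
have cov : S \subset f1 @: (f1 @^-1: S) :|: f2 @: (f2 @^-1: S).
  apply/fintype.subsetP => -[[x|x] h] xhS; rewrite inE; apply/orP; [left|right].
    by apply/imsetP; exists (x, h); rewrite ?inE.
  by apply/imsetP; exists (x, h); rewrite ?inE.
apply: leq_trans (subset_leq_card cov) _.
apply: leq_trans (leq_card_setU _ _) _.
apply: leq_add; apply: leq_trans (leq_imset_card _ _) _;
  apply: alpha_max; apply/independentP => -[x h] [y k] /=;
  rewrite !inE !close_prod /= => xS yS /andP[xy hk].
  have [-> ->] // : (inl x, h) = (inl y, k) :> strong_prod (disjoint_union G1 G2) H.
  by apply: indS => //; rewrite close_prod /= hk andbT.
have [-> ->] // : (inr x, h) = (inr y, k) :> strong_prod (disjoint_union G1 G2) H.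
by apply: indS => //; rewrite close_prod /= hk andbT.
Qed.

(* Unlike [strong_pow], which has no trailing one-vertex factor, this recursion
   is uniform in [n]. *)
Definition pow (G : sgraph) (n : nat) : sgraph :=
  iter n (strong_prod G) one_vertex_graph.

Lemma card_pow (G : sgraph) n : #|pow G n| = #|G| ^ n.
Proof.
elim: n => [|n IHn]; first by rewrite card_unit.
by rewrite expnS -IHn; exact: card_prod.
Qed.

Lemma alpha_strong_pow (G : sgraph) n : alpha (strong_pow G n) = alpha (pow G n).
Proof.
suff [le ge] : cohom (strong_pow G n) (pow G n) /\ cohom (pow G n) (strong_pow G n).
  by apply/eqP; rewrite eqn_leq !alpha_cohom.
case: n => [|n]; first by split; exact: cohom_refl.
elim: n => [|n [IH1 IH2]]; last first.
  by split; apply: cohom_prod => //; exact: cohom_refl.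
split; first by exists (fun x => (x, tt)) => x y; rewrite close_prod => /andP[].
exists (fun u : strong_prod G one_vertex_graph => u.1) => u v uv.
by rewrite close_prod uv.
Qed.

Lemma cohom_powD (G : sgraph) m n :
  cohom (strong_prod (pow G m) (pow G n)) (pow G (m + n)).
Proof.
elim: m => [|m IHm].
  exists (fun u : strong_prod (pow G 0) (pow G n) => u.2) => u v.
  by rewrite close_prod /= => ->; case: u.1; case: v.1.
rewrite addSn /=; apply: cohom_trans (cohom_prod (cohom_refl G) IHm).
exists (fun u : strong_prod (strong_prod G (pow G m)) (pow G n) =>
         (u.1.1, (u.1.2, u.2))).
by move=> u v; rewrite !close_prod /= andbA.
Qed.

(** Supermultiplicativity: after taking logarithms, this is the hypothesis of Fekete's lemma. *)
Lemma alpha_powD (G : sgraph) m n :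
  alpha (pow G m) * alpha (pow G n) <= alpha (pow G (m + n)).
Proof. exact: leq_trans (alpha_prod_ge _ _) (alpha_cohom (cohom_powD _ _ _)). Qed.

Lemma alpha_pow_gt0 (G : sgraph) n : 0 < #|G| -> 0 < alpha (pow G n).
Proof. by move=> G0; apply: alpha_gt0; rewrite card_pow expn_gt0 G0. Qed.

Lemma alpha_pow_le (G : sgraph) n : alpha (pow G n) <= #|G| ^ n.
Proof. by rewrite -card_pow; exact: alpha_le_card. Qed.

(* The graphs met when expanding (G1 + G2)^(a + b + n) one coordinate at a
   time: [a] coordinates were sent to G1, [b] to G2, and [n] are untouched. *)
Definition mixed (G1 G2 : sgraph) a b n : sgraph :=
  strong_prod (pow G1 a) (strong_prod (pow G2 b) (pow (disjoint_union G1 G2) n)).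

(** One untouched coordinate is moved to the front, split by [alpha_union_prod], and absorbed into
    the power of [G1] or of [G2]. *)
Lemma alpha_mixedS (G1 G2 : sgraph) a b n :
  alpha (mixed G1 G2 a b n.+1) <=
  alpha (mixed G1 G2 a.+1 b n) + alpha (mixed G1 G2 a b.+1 n).
Proof.
set H := strong_prod (pow G1 a)
           (strong_prod (pow G2 b) (pow (disjoint_union G1 G2) n)).
apply: (@leq_trans (alpha (strong_prod (disjoint_union G1 G2) H))).
  apply: alpha_cohom.
  apply: cohom_trans (cohom_prod (cohom_refl _) (cohom_prodCA _ _ _)) _.
  exact: cohom_prodCA.
apply: leq_trans (alpha_union_prod _ _ _) _.
apply: leq_add; apply: alpha_cohom; first exact: cohom_prodA.
apply: cohom_trans (cohom_prodCA _ _ _) _.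
by apply: cohom_prod; [exact: cohom_refl|exact: cohom_prodA].
Qed.

(** The geometric mean of the two bounds from [alpha_prod_le_card], one for each order of the
    factors, squared so as to stay in [nat]. *)
Lemma alpha_mixed0 (G1 G2 : sgraph) a b :
  alpha (mixed G1 G2 a b 0) ^ 2 <=
  (alpha (pow G1 a) * #|G1| ^ a) * (alpha (pow G2 b) * #|G2| ^ b).
Proof.
have -> : alpha (pow G1 a) * #|G1| ^ a * (alpha (pow G2 b) * #|G2| ^ b) =
  (alpha (pow G1 a) * #|G2| ^ b) * (alpha (pow G2 b) * #|G1| ^ a) by ring.
rewrite -!card_pow; apply: leq_mul; apply: leq_trans (alpha_prod_le_card _ _);
  apply: alpha_cohom.
  exists (fun u : mixed G1 G2 a b 0 => (u.1, u.2.1)) => u v.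
  by rewrite !close_prod /= => /andP[-> ->]; case: u.2.2; case: v.2.2.
exists (fun u : mixed G1 G2 a b 0 => (u.2.1, u.1)) => u v.
by rewrite !close_prod /= => /andP[-> ->]; case: u.2.2; case: v.2.2.
Qed.

(** * Fekete's lemma and the logarithm of the Shannon capacity *)

Local Open Scope ring_scope.

(** For a superadditive sequence the limit of [u n / n] is its supremum over positive [n], which
    also gives the bound valid for every [n]. *)
Lemma fekete (R : realType) (u : nat -> R) (K : R) :
    (forall m n, u m + u n <= u (m + n)%N) ->
    (forall n, 0 <= u n) -> (forall n, u n <= n%:R * K) ->
  exists2 L : R, (n%:R^-1 * u n @[n --> \oo] --> L)%classic &
    forall n, u n <= n%:R * L.
Proof.
move=> uD u_ge0 uK.
pose E : set R := range (fun n => n.+1%:R^-1 * u n.+1).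
have ubE : has_ubound E.
  by exists K => _ [n _ <-]; rewrite mulrC ler_pdivrMr // mulrC.
have uL n : u n <= n%:R * sup E.
  (* [E] omits the index 0; there the bound reads [u 0 <= 0], which [uK] supplies. *)
  case: n => [|n]; first by have := uK 0%N; rewrite !mul0r.
  by rewrite mulrC -ler_pdivrMr // mulrC; apply: ub_le_sup => //; exists n.
have uM q m : q%:R * u m <= u (q * m)%N.
  elim: q => [|q IHq]; first by rewrite mul0r.
  rewrite mulSn -natr1 mulrDl mul1r addrC.
  by apply: le_trans (uD _ _); rewrite lerD2l.
exists (sup E) => //; apply/cvgrPdist_le => e e0.
(* Half of [e] pays for choosing [M] with [u M / M] near the supremum, the other half for the
   remainder of [n] modulo [M]. *)
have [||_ [m _ <-]] := @sup_adherent _ E (e / 2); first by rewrite divr_gt0.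
  by split=> //; exists (1%:R^-1 * u 1%N); exists 0%N.
set M := m.+1; rewrite ltr_pdivlMl // => supM.
near=> n.
have n0 : 0 < n%:R :> R by rewrite ltr0n; near: n; exact: nbhs_infty_gt.
rewrite ger0_norm ?subr_ge0; last by rewrite mulrC ler_pdivrMr // mulrC.
rewrite lerBlDr -lerBlDl mulrC ler_pdivlMr //.
have uMn : u M <= n%:R * (e / 2).
  rewrite -ler_pdivrMr ?divr_gt0 //; near: n; exact: nbhs_infty_ger.
(* Write [n = q * M + r] with [r < M]. Superadditivity and [0 <= u r] give [q * u M <= u n], while
   [r * u M <= M * u M]. *)
have : n%:R * u M <= M%:R * (u n + u M).
  have /(le_trans _) un := uD (n %/ M * M)%N (n %% M)%N.
  have {}un : (n %/ M)%:R * u M <= u n.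
    by rewrite {2}(divn_eq n M); apply: un; rewrite -[leLHS]addr0 lerD.
  rewrite mulrDr {1}(divn_eq n M) natrD mulrDl natrM.
  apply: lerD; last by rewrite ler_wpM2r // ler_nat ltnW // ltn_mod.
  by rewrite mulrAC mulrC ler_wpM2l.
have M0 : 0 < M%:R :> R by rewrite ltr0n.
move=> nuM; rewrite -(ler_pM2l M0).
have : n%:R * (M%:R * (sup E - e / 2)) <= n%:R * u M.
  by rewrite ler_pM2l // ltW.
have : M%:R * u M <= M%:R * (n%:R * (e / 2)) by rewrite ler_pM2l.
rewrite mulrDr in nuM; lra.
Unshelve. all: by end_near.
Qed.

(** Fekete's lemma for [ln (alpha (pow G n))]: working with [L], the logarithm of the capacity,
    turns n-th roots into division by [n]. *)
Lemma shannon_capacityE (R : realType) (G : sgraph) : (0 < #|G|)%N ->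
  exists L : R, [/\ shannon_capacity R G = expR L,
    (n%:R^-1 * ln (alpha (pow G n))%:R @[n --> \oo] --> L)%classic &
    forall n, ln (alpha (pow G n))%:R <= n%:R * L].
Proof.
move=> G0; have a0 n : 0 < (alpha (pow G n))%:R :> R.
  by rewrite ltr0n alpha_pow_gt0.
have [|||L Lcvg uL] :=
    @fekete R (fun n => ln (alpha (pow G n))%:R) (ln #|G|%:R).
- move=> m n; rewrite -lnM ?posrE // ler_ln ?posrE ?mulr_gt0 //.
  by rewrite -natrM ler_nat alpha_powD.
- by move=> n; rewrite ln_ge0 // ler1n alpha_pow_gt0.
- move=> n; rewrite mulrC mulr_natr -lnXn ?ltr0n // ler_ln ?posrE ?exprn_gt0 ?ltr0n ?alpha_pow_gt0 //.
  by rewrite -natrX ler_nat alpha_pow_le.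
exists L; split => //; apply: cvg_lim => //.
under eq_fun => n do rewrite /powR alpha_strong_pow gt_eqF //.
exact: (cvg_comp _ _ Lcvg (@continuous_expR R L)).
Qed.

(** * Concavity estimates for real powers *)

Lemma powR_Bernoulli (R : realType) (s t : R) : 0 <= s <= 1 -> 0 < t ->
  expR (s * ln t) <= 1 + s * (t - 1).
Proof.
move=> /andP[s0 s1] t0.
have v0 : 0 < 1 + s * (t - 1) by nra.
rewrite -[leRHS]lnK ?posrE // ler_expR.
(* Concavity of [ln] between [t] and [1] with weights [s] and [1 - s]. *)
have := @concave_ln R (Itv01 s0 s1) t 1 t0 ltr01.
rewrite !convRE /= ln1 mulr0 addr0.
have -> // : s * t + unstable.onem s * 1 = 1 + s * (t - 1).
by rewrite /unstable.onem; ring.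
Qed.

(** Bound the power [s] by its tangent line at the midpoint [m] of [a] and [b]. The linear terms
    cancel because [a / m + b / m = 2], leaving twice the power [s] of [m]. *)
Lemma sum_expR_le (R : realType) (s a b : R) :
    0 <= s <= 1 -> 0 < a -> 0 < b ->
  expR (s * ln a) + expR (s * ln b) <= expR (s * ln (a + b) + (1 - s) * ln 2).
Proof.
move=> s01 a0 b0; pose m := (a + b) / 2.
have ab0 : 0 < a + b by rewrite addr_gt0.
have m0 : 0 < m by rewrite divr_gt0.
have lnm : ln m = ln (a + b) - ln 2 by rewrite /m ln_div ?posrE.
have bound c : 0 < c ->
    expR (s * ln c) <= expR (s * ln m) * (1 + s * (c / m - 1)).
  move=> c0; have cm0 : 0 < c / m by rewrite divr_gt0.
  have -> : s * ln c = s * ln m + s * ln (c / m).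
    by rewrite [ln (c / m)]ln_div ?posrE //; ring.
  by rewrite expRD ler_pM2l ?expR_gt0 //; exact: powR_Bernoulli.
have -> : s * ln (a + b) + (1 - s) * ln 2 = s * ln m + ln 2 by rewrite lnm; ring.
rewrite expRD lnK ?posrE //.
apply: (le_trans (lerD (bound _ a0) (bound _ b0))).
rewrite -mulrDr ler_pM2l ?expR_gt0 // le_eqVlt; apply/orP; left; apply/eqP.
by rewrite /m; field; rewrite gt_eqF.
Qed.

(** The case [s = (1 + e) / 2], with [l1] and [l2] standing for the logarithms of the two
    capacities. *)
Lemma sum_half_expR_le (R : realType) (a b l1 l2 e : R) :
    0 <= e <= 1 -> 0 < a -> 0 < b -> l1 <= e * ln a -> l2 <= e * ln b ->
  expR ((l1 + ln a) / 2) + expR ((l2 + ln b) / 2) <=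
  expR ((1 + e) / 2 * ln (a + b) + (1 - e) / 2 * ln 2).
Proof.
move=> /andP[e0 e1] a0 b0 l1e l2e.
have -> : (1 - e) / 2 = 1 - (1 + e) / 2 by field.
apply: le_trans (sum_expR_le _ a0 b0); last by apply/andP; split; lra.
by apply: lerD; rewrite ler_expR; lra.
Qed.

(** * Independent sets in powers of the disjoint union *)

Section DisjointUnionCapacity.
Variables (R : realType) (G1 G2 : sgraph) (L1 L2 : R).
Hypotheses (G1_gt0 : (0 < #|G1|)%N) (G2_gt0 : (0 < #|G2|)%N).
Hypothesis alpha_pow1 : forall n, ln (alpha (pow G1 n))%:R <= n%:R * L1.
Hypothesis alpha_pow2 : forall n, ln (alpha (pow G2 n))%:R <= n%:R * L2.

Let x := expR ((L1 + ln #|G1|%:R) / 2).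
Let y := expR ((L2 + ln #|G2|%:R) / 2).

Let alpha_card_pow (G : sgraph) (L : R) n : (0 < #|G|)%N ->
  ln (alpha (pow G n))%:R <= n%:R * L ->
  (alpha (pow G n) * #|G| ^ n)%:R <= expR ((L + ln #|G|%:R) / 2) ^+ n ^+ 2.
Proof.
move=> G0 aL; have N0 : 0 < #|G|%:R :> R by rewrite ltr0n.
(* Swapping the exponents [n] and 2 lets the square cancel the halving, leaving the n-th power of
   [expR L * #|G|]. *)
rewrite exprAC -expRM_natl mulrCA mulfV // mulr1 -expRM_natl mulrDr expRD.
rewrite natrM natrX; apply: ler_pM; rewrite ?exprn_ge0 //.
  by rewrite -[leLHS]lnK ?ler_expR // posrE ltr0n alpha_pow_gt0.
by rewrite expRM_natl lnK.
Qed.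

Lemma alpha_mixed_le a b n :
  (alpha (mixed G1 G2 a b n))%:R <= x ^+ a * y ^+ b * (x + y) ^+ n.
Proof.
have [x0 y0] : 0 <= x /\ 0 <= y by rewrite !expR_ge0.
(* Both [a] and [b] vary in the induction: each step raises one of them. The base case compares
   squares, matching [alpha_mixed0]. *)
elim: n a b => [|n IHn] a b.
  rewrite mulr1 -ler_sqr ?nnegrE ?mulr_ge0 ?exprn_ge0 //.
  rewrite exprMn -natrX; apply: (@le_trans _ _
    ((alpha (pow G1 a) * #|G1| ^ a) * (alpha (pow G2 b) * #|G2| ^ b))%:R).
    by rewrite ler_nat alpha_mixed0.
  by rewrite natrM; apply: ler_pM => //; exact: alpha_card_pow.
have := alpha_mixedS G1 G2 a b n; rewrite -(ler_nat R) natrD => /le_trans; apply.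
apply: (le_trans (lerD (IHn _ _) (IHn _ _))).
by rewrite !exprS le_eqVlt; apply/orP; left; apply/eqP; ring.
Qed.

Lemma alpha_pow_union_le n :
  (alpha (pow (disjoint_union G1 G2) n))%:R <= (x + y) ^+ n.
Proof.
rewrite -[leRHS]mul1r -[X in X * _]mul1r.
apply: le_trans (alpha_mixed_le 0 0 n); rewrite ler_nat; apply: alpha_cohom.
exists (fun u => (tt, (tt, u))) => u v.
by rewrite !close_prod => /andP[_ /andP[]].
Qed.

End DisjointUnionCapacity.

Theorem theorem1 (R : realType) (G1 G2 : sgraph) (epsilon : R)
    (hG1 : (2 <= #|G1|)%N) (hG2 : (2 <= #|G2|)%N)
    (hC1 : normalized_capacity R G1 <= epsilon)
    (hC2 : normalized_capacity R G2 <= epsilon) :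
  normalized_capacity R (disjoint_union G1 G2) <=
    (1 + epsilon) / 2 + (1 - epsilon) / (2 * log2 ((#|G1| + #|G2|)%:R : R)).
Proof.
have G1_gt0 : (0 < #|G1|)%N by exact: leq_trans hG1.
have G2_gt0 : (0 < #|G2|)%N by exact: leq_trans hG2.
have cardU : #|disjoint_union G1 G2| = (#|G1| + #|G2|)%N by exact: card_sum.
have [|L [cE Lcvg _]] := @shannon_capacityE R (disjoint_union G1 G2).
  by rewrite cardU addn_gt0 G1_gt0.
have [L1 [c1E _ L1ub]] := shannon_capacityE R G1_gt0.
have [L2 [c2E _ L2ub]] := shannon_capacityE R G2_gt0.
(* Since [L] is the limit of the normalized logarithms, an exponential bound at every [n] passes to
   [L]. *)
have L_le K : (forall n, (alpha (pow (disjoint_union G1 G2) n))%:R <= expR K ^+ n) ->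
    L <= K.
  move=> aK; apply: (cvgr_to_le Lcvg); near=> n.
  have n0 : 0 < n%:R :> R by rewrite ltr0n; near: n; exact: nbhs_infty_gt.
  rewrite ler_pdivrMl // -[leRHS]expRK ler_ln ?posrE ?expR_gt0 ?expRM_natl //.
  by rewrite ltr0n alpha_pow_gt0 // cardU addn_gt0 G1_gt0.
rewrite /normalized_capacity cE c1E c2E !expRK cardU /log2 in hC1 hC2 *.
have N1_gt0 : 0 < #|G1|%:R :> R by rewrite ltr0n.
have N2_gt0 : 0 < #|G2|%:R :> R by rewrite ltr0n.
have ln2_gt0 : 0 < ln 2 :> R by rewrite ln_gt0 // ltr1n.
have lnN1_gt0 : 0 < ln #|G1|%:R :> R by rewrite ln_gt0 // ltr1n.
have lnN2_gt0 : 0 < ln #|G2|%:R :> R by rewrite ln_gt0 // ltr1n.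
have lnN_ge : ln 2 <= ln (#|G1| + #|G2|)%:R :> R.
  by rewrite ler_ln ?posrE ?ltr0n ?addn_gt0 ?G1_gt0 // ler_nat (leq_trans hG1) ?leq_addr.
have lnN_gt0 := lt_le_trans ln2_gt0 lnN_ge.
move: hC1 hC2; rewrite !ler_pdivrMr // => hC1 hC2.
(* [alpha (pow G1 1)] is at least 1, so [L1], and with it the normalized capacity of [G1], is
   nonnegative. *)
have eps_ge0 : 0 <= epsilon.
  rewrite -(pmulr_lge0 _ lnN1_gt0); apply: le_trans hC1.
  have := L1ub 1%N; rewrite mul1r; apply: le_trans.
  by rewrite ln_ge0 // ler1n alpha_pow_gt0.
(* The goal multiplied by [ln (#|G1| + #|G2|)]; unfolding [log2] produces the term in [ln 2]. *)
suff : L <= (1 + epsilon) / 2 * ln (#|G1| + #|G2|)%:R + (1 - epsilon) / 2 * ln 2.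
  move/le_trans; apply; rewrite le_eqVlt; apply/orP; left; apply/eqP.
  by field; rewrite !gt_eqF.
have [eps_le1|eps_gt1] := leP epsilon 1; last first.
  have : L <= ln (#|G1| + #|G2|)%:R.
    apply: L_le => n; rewrite lnK ?posrE ?ltr0n ?addn_gt0 ?G1_gt0 //.
    by rewrite -natrX ler_nat -cardU alpha_pow_le.
  move: lnN_ge eps_gt1; clear.
  (* With [u] the logarithm of the total number of vertices and [v = ln 2], the target exceeds [u]
     by [(epsilon - 1) / 2 * (u - v)], which is nonnegative. *)
  by move: (ln _) (ln 2) => u v uv e1 Lu; nra.
apply: L_le => n; apply: le_trans (alpha_pow_union_le G1_gt0 G2_gt0 L1ub L2ub n) _.
apply: lerXn2r; rewrite ?nnegrE ?addr_ge0 ?expR_ge0 // natrD.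
by apply: sum_half_expR_le; rewrite ?eps_ge0.
Unshelve. all: by end_near.
Qed.
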